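(* Let $\mathcal{B},\mathcal{C}$ be barriers on $\omega$ with $\mathcal{C}$ uniform and $\rho(\mathcal{B})<\rho(\mathcal{C})$. Then $\mathsf{FIN}^{\mathcal{C}}\not\leq_K\mathcal{G}_c(\mathcal{B})$.
   Context: For sets of naturals, $s\sqsubseteq t$ means $s$ is an initial segment of $t$. For $\mathcal{F}\subseteq[\omega]^{<\omega}$ and $M\subseteq\omega$ let $\mathcal{F}|M=\{s\in\mathcal{F}:s\subseteq M\}$. A barrier on an infinite set $M\subseteq\omega$ is a family $\mathcal{B}$ of finite subsets of $M$ such that (a) $s\subseteq t$ implies $s=t$ for $s,t\in\mathcal{B}$, and (b) every infinite $N\subseteq M$ has an initial segment $s\sqsubseteq N$ with $s\in\mathcal{B}$. For $n\in M$ put $\mathcal{B}(n)=\{t\in\mathcal{B}:\min t=n\}$ and $\mathcal{B}[n]=\{t\setminus\{n\}:t\in\mathcal{B}(n)\}$, which is a barrier on $M\setminus(n+1)$ when $\mathcal B\neq\{\emptyset\}$. Rank: $T(\mathcal{B})=\{s\in[\omega]^{<\omega}:\exists t\in\mathcal{B}\,(s\sqsubseteq t)\}$, $\rho_{T(\mathcal{B})}(s)=\sup\{\rho_{T(\mathcal{B})}(t)+1:t\in T(\mathcal{B}),\ s\sqsubseteq t,\ s\neq t\}$ (with $\sup\emptyset=0$), and $\rho(\mathcal{B})=\rho_{T(\mathcal{B})}(\emptyset)<\omega_1$. Uniform barriers, by recursion on rank: $\{\emptyset\}$ (rank $0$) and $[M]^1$ (rank $1$) are uniform; a barrier $\mathcal{B}$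 on $M$ of rank $\alpha>1$ is uniform if each $\mathcal{B}[n]$ ($n\in M$) is a uniform barrier on $M\setminus(n+1)$ and either $\alpha=\beta+1$ and $\rho_{T(\mathcal{B})}(\{n\})=\beta$ for all $n\in M$, or $\alpha$ is a limit and $\{\rho_{T(\mathcal{B})}(\{n\}):n\in M\}$ is an increasing sequence with limit $\alpha$. Ideals: for a barrier $\mathcal{B}$, $\mathsf{FIN}^{\mathcal{B}}$ is the ideal on $\mathcal{B}$ defined recursively: $\mathsf{FIN}^{\{\emptyset\}}=\{\emptyset\}$ (only the empty subset of $\{\emptyset\}$), and otherwise $X\subseteq\mathcal{B}$ is in $\mathsf{FIN}^{\mathcal{B}}$ iff the set of $n$ such that $\{s\setminus\{n\}:s\in X\cap\mathcal{B}(n)\}\notin\mathsf{FIN}^{\mathcal{B}[n]}$ is finite. $\mathcal{G}_c(\mathcal{B})$ is the ideal on $\mathcal{B}$ of all $S\subseteq\mathcal{B}$ for which there is no infinite $X\subseteq\omega$ with $\mathcal{B}|X\subseteq S$. Katětov order: for ideals $\mathcal{I}$ on $X$ and $\mathcal{J}$ on $Y$ ($X,Y$ countable), $\mathcal{I}\leq_K\mathcal{J}$ iff there is $f:Y\to X$ with $f^{-1}(A)\in\mathcal{J}$ for all $A\in\mathcal{I}$. *)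

(* Defs.v *)
From mathcomp Require Import all_boot finmap.
From mathcomp Require Import mathcomp_extra boolp classical_sets functions.
From mathcomp Require Import cardinality.

Set Implicit Arguments.
Unset Strict Implicit.
Unset Printing Implicit Defensive.

Local Open Scope classical_set_scope.

(* [Osup f] is the least ordinal strictly above all [f i], that is
   sup {f i + 1 | i : I}.  Ordinals are represented by such well-founded trees,
   so equality of ordinals is [oeq], not Leibniz equality. *)
Inductive ord : Type := Osup (I : Type) (f : I -> ord).

Fixpoint ole (a b : ord) {struct a} : Prop :=
  match a, b with
  | @Osup K f, @Osup L g => forall i : K, exists j : L, ole (f i) (g j)
  end.

Definition oeq (a b : ord) : Prop := ole a b /\ ole b a.
Definition ozero : ord := Osup (fun i : False => match i with end).
Definition osucc (a : ord) : ord := Osup (fun _ : unit => a).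
Definition olt (a b : ord) : Prop := ole (osucc a) b.

Definition olimit (a : ord) : Prop :=
  ~ oeq a ozero /\ ~ (exists b, oeq a (osucc b)).

Definition is_osup (A : set nat) (r : nat -> ord) (a : ord) : Prop :=
  (forall n, A n -> ole (r n) a) /\
  (forall b, (forall n, A n -> ole (r n) b) -> ole a b).

Definition initseg (s t : set nat) : Prop :=
  s `<=` t /\ (forall m k, t m -> s k -> m <= k -> s m).

Definition barrier (M : set nat) (B : set {fset nat}) : Prop :=
  [/\ infinite_set M,
      (forall s, B s -> [set` s] `<=` M),
      (forall s t, B s -> B t -> (s `<=` t)%fset -> s = t) &
      (forall N : set nat, infinite_set N -> N `<=` M ->
         exists2 s, B s & initseg [set` s] N)].

(* F|M *)
Definition frestr (F : set {fset nat}) (M : set nat) : set {fset nat} :=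
  [set s | F s /\ [set` s] `<=` M].

(* B(n), and B[n] *)
Definition minpart (B : set {fset nat}) (n : nat) : set {fset nat} :=
  [set t | [/\ B t, n \in t & forall m, m \in t -> n <= m]].
Definition section (B : set {fset nat}) (n : nat) : set {fset nat} :=
  [set (t `\ n)%fset | t in minpart B n].

(* M \ (n+1), where n+1 = {0, ..., n} *)
Definition tail (M : set nat) (n : nat) : set nat := [set m | M m /\ n < m].

Definition tree (B : set {fset nat}) : set {fset nat} :=
  [set s | exists2 t, B t & initseg [set` s] [set` t]].

Definition pext (T : set {fset nat}) (t s : {fset nat}) : Prop :=
  [/\ T t, initseg [set` s] [set` t] & s <> t].

Fixpoint rank_acc (T : set {fset nat}) (s : {fset nat})
    (a : Acc (pext T) s) {struct a} : ord :=
  Osup (fun t : {t | pext T t s} => rank_acc (Acc_inv a (proj2_sig t))).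

(* The value [ozero] on an ill-founded part of the tree is junk; it does not
   occur for trees of barriers, see [barrier_wf] and [rankE]. *)
Definition rank (T : set {fset nat}) (s : {fset nat}) : ord :=
  match pselect (Acc (pext T) s) with
  | left a => rank_acc a
  | right _ => ozero
  end.

Definition rho (B : set {fset nat}) : ord := rank (tree B) fset0.

Definition singletons (M : set nat) : set {fset nat} :=
  [set [fset n]%fset | n in M].

Inductive uniform (M : set nat) (B : set {fset nat}) : Prop :=
| Uniform0 of barrier M B & B = [set fset0]
| Uniform1 of barrier M B & B = singletons M
| UniformS (beta : ord) of
    barrier M B &
    olt (osucc ozero) (rho B) &
    (forall n, M n -> uniform (tail M n) (section B n)) &
    oeq (rho B) (osucc beta) &
    (forall n, M n -> oeq (rank (tree B) [fset n]%fset) beta)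
| UniformL of
    barrier M B &
    olt (osucc ozero) (rho B) &
    (forall n, M n -> uniform (tail M n) (section B n)) &
    olimit (rho B) &
    (forall n m, M n -> M m -> n < m ->
       olt (rank (tree B) [fset n]%fset)
           (rank (tree B) [fset m]%fset)) &
    is_osup M (fun n => rank (tree B) [fset n]%fset) (rho B).

(* The exceptional set {n | X[n] is not in FIN^{B[n]}} is contained in the
   finite set [F]; [FIN_stepP] gives the recursive characterization.  The
   index n ranges over those with B(n) nonempty, i.e. over the base set of B
   when B is a barrier other than {emptyset}. *)
Inductive FIN (B X : set {fset nat}) : Prop :=
| FIN0 of B = [set fset0] & X = set0
| FINS (F : {fset nat}) of
    B <> [set fset0] &
    X `<=` B &
    (forall n, minpart B n !=set0 -> n \notin F ->
       FIN (section B n) (section X n)).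

Definition Gc (B S : set {fset nat}) : Prop :=
  S `<=` B /\
  ~ (exists X : set nat, infinite_set X /\ frestr B X `<=` S).

Definition katetov_le (T U : Type) (X : set T) (I : set (set T))
    (Y : set U) (J : set (set U)) : Prop :=
  exists2 f : U -> T, set_fun Y X f &
    forall A, I A -> J (Y `&` f @^-1` A).

Lemma FIN_emptyP (X : set {fset nat}) : FIN [set fset0] X <-> X = set0.
Proof. by split=> [[]//|->]; apply: FIN0. Qed.

Lemma FIN_stepP (B X : set {fset nat}) : B <> [set fset0] ->
  FIN B X <->
  X `<=` B /\ finite_set [set n | minpart B n !=set0 /\
                                  ~ FIN (section B n) (section X n)].
Proof.
move=> B0; split=> [[//|F _ XB H]|[XB /finite_fsetP[F EF]]].
  split=> //; apply: (sub_finite_set _ (finite_fset F)) => n [/= Bn nF].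
  by apply: contrapT => /negP nF'; apply: nF; apply: H.
apply: (@FINS _ _ F) => // n Bn /negP nF; apply: contrapT => nFIN; apply: nF.
suff : [set` F] n by [].
by rewrite -EF.
Qed.

Lemma rankE (T : set {fset nat}) (s : {fset nat}) : Acc (pext T) s ->
  rank T s = Osup (fun t : {t | pext T t s} => rank T (proj1_sig t)).
Proof.
move=> a0; rewrite {1}/rank; case: pselect => // a; case: a => h /=.
congr Osup; apply: funext => -[t pt] /=.
rewrite /rank; case: pselect => [b|[]]; last exact: h.
by congr rank_acc; apply: Prop_irrelevance.
Qed.

Lemma initseg_fsub (s t : {fset nat}) : initseg [set` s] [set` t] -> (s `<=` t)%fset.
Proof. by move=> [st _]; apply/fsubsetP => x; apply: st. Qed.

Lemma barrier_wf (M : set nat) (B : set {fset nat}) :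
  barrier M B -> well_founded (pext (tree B)).
Proof.
move=> [_ BM Banti Bdense] s0; apply: contrapT => ns0.
pose S := {s | ~ Acc (pext (tree B)) s}.
have next (s : S) : exists t : S, pext (tree B) (proj1_sig t) (proj1_sig s).
  case: s => s ns /=; apply: contrapT => H; apply: ns; apply: Acc_intro => t pt.
  by apply: contrapT => nt; apply: H; exists (exist _ t nt).
have [g gP] := choice next.
pose u k := proj1_sig (iter k g (exist _ s0 ns0)).
have uP k : pext (tree B) (u k.+1) (u k) by exact: gP.
have uS k : (u k `<=` u k.+1)%fset by have [_ /initseg_fsub] := uP k.
have umono k l : k <= l -> (u k `<=` u l)%fset.
  by move=> /subnK <-; elim: (l - k) => //= d IH; apply: fsubset_trans (uS _).
have ucard k : k <= #|` u k|.
  elim: k => // k IH; apply: (leq_ltn_trans IH); apply: fproper_ltn_card.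
  by have [_ _ /eqP] := uP k; rewrite fproperEneq uS andbT.
pose N : set nat := [set x | exists k, x \in u k].
have Ninf : infinite_set N.
  move=> /finite_fsetP[F NF].
  have : #|` u #|` F|.+1| <= #|` F|.
    apply: fsubset_leq_card; apply/fsubsetP => x xu.
    suff : [set` F] x by [].
    by rewrite -NF; exists #|` F|.+1.
  by rewrite leqNgt (ucard #|` F|.+1).
have NM : N `<=` M.
  move=> x [k xk]; have [[t Bt [ut _]] _ _] := uP k.
  by apply: (BM _ Bt); apply: ut; apply: (fsubsetP (uS k)).
have [s Bs [sN _]] := Bdense N Ninf NM.
have [k sk] : exists k, (s `<=` u k)%fset.
  have hex x : exists k, x \in s -> x \in u k.
    case: (boolP (x \in s)) => [/sN[k xk]|_]; first by exists k.
    by exists 0.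
  have [h hP] := choice hex.
  exists (\max_(x <- s) h x); apply/fsubsetP => x xs.
  by apply: (fsubsetP (umono _ _ _) _ (hP _ xs)); apply: leq_bigmax_seq.
have [[t Bt /initseg_fsub ut] _ uk] := uP k.
have st : s = t.
  by apply: Banti => //; apply: fsubset_trans sk (fsubset_trans (uS k) ut).
apply: uk; apply/eqP; rewrite eqEfsubset uS /=.
by apply: fsubset_trans ut _; rewrite -st.
Qed.

Lemma rank_barrierE (M : set nat) (B : set {fset nat}) (s : {fset nat}) :
  barrier M B ->
  rank (tree B) s =
  Osup (fun t : {t | pext (tree B) t s} => rank (tree B) (proj1_sig t)).
Proof. by move=> bB; apply: rankE; apply: (barrier_wf bB). Qed.

(* Main.v *)
(** Given [f : B -> C], one finds an infinite [X] such that the image of [B|X]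
    lies in [FIN^C], by induction on the nodes [u] of the tree of [B], for all
    uniform [C] whose rank exceeds that of [u].  By Nash-Williams' theorem and a
    diagonalization, [X] can be chosen so that, for all [n] except possibly one,
    the [s] with [min (f s) = n] have only finitely many possible next elements
    [m] above [u].  By uniformity, [C[n]] has rank at least that of [u] for
    almost all [n], so each child [u U {m}] is covered by the induction
    hypothesis for [C[n]], and the [n]-th section of the image is a finite union
    of members of [FIN^{C[n]}]. *)

Require Import Defs.
From mathcomp Require Import all_boot finmap.
From mathcomp Require Import boolp classical_sets functions cardinality.

Set Implicit Arguments.
Unset Strict Implicit.
Unset Printing Implicit Defensive.

Local Open Scope classical_set_scope.

(** * Order on tree-represented ordinals *)

Lemma ole_refl a : ole a a.
Proof. by elim: a => I f IH /= i; exists i. Qed.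

Lemma ole_trans b a c : ole a b -> ole b c -> ole a c.
Proof.
elim: a b c => I f IH [J g] [K h] /= fg gh i.
by have [j fgj] := fg i; have [k ghk] := gh j; exists k; apply: IH fgj ghk.
Qed.

Lemma ole_child I (f : I -> ord) i : ole (f i) (Osup f).
Proof.
(* Generalized to any family with [a] as a member, so that the induction hypothesis applies with the
   family [h] below [a]. *)
have: forall a J (g : J -> ord) j, a = g j -> ole a (Osup g).
  elim=> K h IH J g j gj k; exists j; rewrite -gj; exact: IH (erefl _).
exact.
Qed.

Lemma ole_osucc a : ole a (osucc a).
Proof. exact: (@ole_child unit (fun=> a) tt). Qed.

Lemma oltW a b : olt a b -> ole a b.
Proof. exact/ole_trans/ole_osucc. Qed.

Lemma olt_irr a : ~ olt a a.
Proof.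
elim: a => I f IH /(_ tt)[i fi]; apply: (IH i); apply: (@ole_trans (Osup f) _ _ _ fi) => -[].
by exists i; apply: ole_refl.
Qed.

Lemma olt_osucc a b : olt a (osucc b) -> ole a b.
Proof. by move=> /(_ tt)[]. Qed.

(** Either one child of [a] strictly exceeds every child of [b], or by induction every child of [a]
    lies below some child of [b]. *)
Lemma ole_or_olt a b : ole a b \/ olt b a.
Proof.
elim: a b => I f IH [J g].
have [[i H]|H] := pselect (exists i, forall j, olt (g j) (f i)).
  right=> -[]; exists i.
  by move: H; case: (f i) => K h H j; have [k] := H j tt; exists k.
left=> i; apply: contrapT => nH; apply: H; exists i => j.
by have [fg|//] := IH i (g j); case: nH; exists j.
Qed.

(** * Infinite sets and diagonalization *)

Lemma infinite_tail X k : infinite_set X -> infinite_set (tail X k).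
Proof.
move=> Xinf tfin; apply: Xinf.
apply: (@sub_finite_set _ _ (tail X k `|` `I_k.+1)).
  move=> x Xx; have [kx|xk] := ltnP k x; [by left|by right].
by rewrite finite_setU; split=> //; apply: finite_II.
Qed.

Lemma infinite_mem_gt X k : infinite_set X -> exists2 x, X x & k < x.
Proof.
by move=> /(@infinite_tail _ k)/infinite_setN0[x [Xx kx]]; exists x.
Qed.

(** Fusion: pick [x j] in [Q j], then shrink the rest of [Q j] to a set [Q j.+1] satisfying [P i]
    for all [i <= x j]. The chosen points above [x j] all lie in [Q j.+1], so heredity passes [P i]
    to them. *)
Lemma diagonal_subset (P : nat -> set nat -> Prop) (Y : set nat) :
  (forall i X X', X' `<=` X -> P i X -> P i X') ->
  (forall i X, infinite_set X -> X `<=` Y ->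
    exists X', [/\ infinite_set X', X' `<=` X & P i X']) ->
  infinite_set Y ->
  exists X, [/\ infinite_set X, X `<=` Y &
    forall m i, X m -> i <= m -> P i (tail X m)].
Proof.
move=> Phered Pdense Yinf.
have Pdense_le k X : infinite_set X -> X `<=` Y ->
    exists X', [/\ infinite_set X', X' `<=` X & forall i, i < k -> P i X'].
  elim: k X => [|k IH] X Xinf XY; first by exists X; split.
  have [X1 [X1inf X1X PX1]] := IH X Xinf XY.
  have [X2 [X2inf X2X1 PX2]] := Pdense k X1 X1inf (subset_trans X1X XY).
  exists X2; split=> // [|i]; first exact: subset_trans X2X1 X1X.
  rewrite ltnS leq_eqVlt => /orP[/eqP->//|ik].
  exact: Phered X2X1 (PX1 i ik).
pose St := {X : set nat | infinite_set X /\ X `<=` Y}.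
have step (S : St) : exists p : nat * St,
    [/\ sval S p.1, sval p.2 `<=` tail (sval S) p.1 &
        forall i, i <= p.1 -> P i (sval p.2)].
  case: S => S [Sinf SY]; have [x Sx] := infinite_setN0 Sinf.
  have tY : tail S x `<=` Y by move=> y [/SY].
  have [X [Xinf XS PX]] := Pdense_le x.+1 _ (infinite_tail (k := x) Sinf) tY.
  by exists (x, exist _ X (conj Xinf (subset_trans XS tY))).
have [g gP] := choice step.
pose Q j := iter j (fun S => (g S).2) (exist _ Y (conj Yinf (@subset_refl _ Y)) : St).
pose x j := (g (Q j)).1.
have xQ j : sval (Q j) (x j) by have [] := gP (Q j).
have QS j : sval (Q j.+1) `<=` tail (sval (Q j)) (x j) by have [] := gP (Q j).
have Qle j l : j <= l -> sval (Q l) `<=` sval (Q j).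
  move=> /subnK <-; elim: (l - j) => // d IH y Qy; apply: IH.
  by have [] := QS _ _ Qy.
have xlt j l : j < l -> x j < x l.
  by move=> jl; have [] := QS j (x l) (Qle _ _ jl _ (xQ l)).
have xinj : injective x.
  by move=> j l jl; case: (ltngtP j l) => // /xlt; rewrite jl ltnn.
exists (range x); split.
- move=> /(finite_preimage (f := x)) fin; apply: infinite_nat.
  apply: sub_finite_set (fin _) => [j _|j l _ _ /xinj//]; by exists j.
- by move=> _ [j _ <-]; have [_] := svalP (Q j); apply.
move=> _ i [j _ <-] ij; have [_ _ /(_ i ij)] := gP (Q j).
apply: Phered => _ [[l _ <-] xjl].
apply: (Qle j.+1 l) (xQ l); rewrite ltnNge; apply/negP => lj.
by move: xjl; rewrite ltnNge; case: (ltngtP l j) lj => [/xlt/ltnW->|//|->]; rewrite ?leqnn.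
Qed.

(** * Nash-Williams' theorem above a node of the tree *)

(** The elements of [u] are exempt from lying in [X], so [X] can be shrunk while [u] stays fixed;
    for empty [u] this is [B|X]. *)
Definition through (B : set {fset nat}) (u : {fset nat}) (X : set nat) :
    set {fset nat} :=
  [set s | [/\ B s, initseg [set` u] [set` s] &
               forall x, x \in s -> x \in u \/ X x]].

Definition thin (B : set {fset nat}) :=
  forall s t, B s -> B t -> initseg [set` s] [set` t] -> s = t.

Lemma through_sub B u X X' : X `<=` X' -> through B u X `<=` through B u X'.
Proof. by move=> XX' s [Bs us sX]; split=> // x /sX[|/XX']; [left|right]. Qed.

Lemma through_leaf B u X : thin B -> B u -> through B u X `<=` [set u].
Proof. by move=> Bthin Bu s [Bs us _]; rewrite /= (Bthin u s). Qed.

Lemma through_child B u X s : through B u X s -> s <> u ->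
  exists m, [/\ X m, pext (tree B) (m |` u)%fset u &
                through B (m |` u)%fset (tail X m) s].
Proof.
move=> [Bs [us useg] sX] /eqP su.
have /fset0Pn[x0] : (s `\` u)%fset != fset0.
  apply: contra su; rewrite fsetD_eq0 => su.
  by rewrite eqEfsubset su; apply/fsubsetP => x; apply: us.
(* The child adds the least element [m] of [s] outside [u]; minimality puts the rest of [s] above
   [m]. *)
rewrite inE => x0s; pose Q x := (x \notin u) && (x \in s).
have [m /andP[mu ms] mmin] := ex_minnP (ex_intro Q x0 x0s).
have seg : initseg [set` (m |` u)%fset] [set` s].
  split=> [x /=|x k /= xs].
    by rewrite !inE => /orP[/eqP->//|/us].
  rewrite !inE => /orP[/eqP->|ku xk]; last by rewrite (useg x k)// orbT.
  have [//|xu] := boolP (x \in u); first by rewrite orbT.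
  by move=> xm; rewrite orbF eqn_leq xm mmin// /Q xu.
exists m; split.
- by have [mu'|//] := sX m ms; rewrite mu' in mu.
- split; first by exists s.
    split=> [x /= xu|x k /=]; first by rewrite !inE xu orbT.
    rewrite !inE => /orP[/eqP-> ku mk|//]; exact: useg ku mk.
  by move=> E; move: mu; rewrite E !inE eqxx.
- split=> // x xs; have [xu|xu] := boolP (x \in u).
    by left; rewrite !inE xu orbT.
  have [|Xx] := sX x xs; first by rewrite (negPf xu).
  have [->|xm] := eqVneq x m; first by left; rewrite !inE eqxx.
  by right; split=> //; rewrite ltn_neqAle eq_sym xm mmin// /Q xu.
Qed.

(** By induction each child of [u] can be made homogeneous; diagonalization does this for all
    children at once, and a pigeonhole on their colours makes [u] homogeneous. *)
Lemma nash_williams B (S : set {fset nat}) u Y :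
  well_founded (pext (tree B)) -> thin B -> infinite_set Y ->
  exists X, [/\ infinite_set X, X `<=` Y &
    through B u X `<=` S \/ through B u X `<=` ~` S].
Proof.
move=> Bwf Bthin; elim/(well_founded_ind Bwf): u Y => u IH Y Yinf.
have [Bu|nBu] := pselect (B u).
  exists Y; split=> //; have [Su|nSu] := pselect (S u); [left|right];
  by move=> s /(through_leaf Bthin Bu) ->.
pose P m X := pext (tree B) (m |` u)%fset u ->
  through B (m |` u)%fset X `<=` S \/ through B (m |` u)%fset X `<=` ~` S.
have [|m X Xinf XY|X [Xinf XY PX]] := @diagonal_subset P Y _ _ Yinf.
- move=> m X X' X'X PX mu.
  by have [H|H] := PX mu; [left|right]; apply: subset_trans H; apply: through_sub.
- have [mu|nmu] := pselect (pext (tree B) (m |` u)%fset u); last by exists X; split.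
  by have [X' [? ? ?]] := IH _ mu X Xinf; exists X'; split.
(* The children not coloured by [S]: drop them if [X] contains finitely many, otherwise keep only
   them. *)
pose D := [set m | pext (tree B) (m |` u)%fset u /\
                   ~ through B (m |` u)%fset (tail X m) `<=` S].
have small A : A `<=` X -> through B u A `<=`
    [set s | exists m, [/\ A m, pext (tree B) (m |` u)%fset u &
                           through B (m |` u)%fset (tail X m) s]].
  move=> AX s us; have su : s <> u by move=> E; apply: nBu; rewrite -E; case: us.
  have [m [Am mu ms]] := through_child us su; exists m; split=> //.
  by apply: through_sub ms => x [/AX].
have [Dfin|Dinf] := pselect (finite_set (X `&` D)).
  exists (X `\` D); split.
  - move=> Efin; apply: Xinf; rewrite -(setUIDK X D).
    by rewrite finite_setU.
  - by apply: subset_trans XY; apply: subDsetl.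
  left=> s /small[]; first exact: subDsetl.
  move=> m [[Xm nDm] mu ms]; apply: contrapT => nSs; apply: nDm.
  by split=> // /(_ _ ms).
exists (X `&` D); split=> //; first by move=> x [/XY].
right=> s /small[]; first exact: subIsetl.
move=> m [[Xm [_ nS]] mu ms]; have [//|] := PX m m Xm (leqnn m) mu.
exact.
Qed.

(** * Comparison of ranks in trees *)

Lemma rank_pext T s t : well_founded (pext T) -> pext T t s ->
  olt (rank T t) (rank T s).
Proof.
move=> Twf ts; rewrite (rankE (Twf s)) => -[]; exists (exist _ t ts).
exact: ole_refl.
Qed.

Lemma olt_rank T s a : well_founded (pext T) -> olt a (rank T s) ->
  exists2 t, pext T t s & ole a (rank T t).
Proof. by move=> Twf; rewrite (rankE (Twf s)) => /(_ tt)[[t ts] at_]; exists t. Qed.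

Lemma rank_simulation T T' (R : {fset nat} -> {fset nat} -> Prop) s s' :
  well_founded (pext T) -> well_founded (pext T') ->
  (forall s s' t, R s s' -> pext T t s -> exists2 t', pext T' t' s' & R t t') ->
  R s s' -> ole (rank T s) (rank T' s').
Proof.
move=> Twf Twf' sim; elim/(well_founded_ind Twf): s s' => s IH s' Rss'.
rewrite (rankE (Twf s)) (rankE (Twf' s')) => -[t ts] /=.
have [t' ts' Rtt'] := sim _ _ _ Rss' ts.
by exists (exist _ t' ts'); apply: IH.
Qed.

Lemma rank_leaf T s b : well_founded (pext T) -> (forall t, ~ pext T t s) ->
  ole (rank T s) b.
Proof. by move=> Twf sleaf; rewrite (rankE (Twf s)); case: b => I f [t ts]; case: (sleaf t ts). Qed.

Lemma rank_section B n :
  well_founded (pext (tree B)) -> well_founded (pext (tree (section B n))) ->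
  ole (rank (tree B) [fset n]%fset) (rho (section B n)).
Proof.
move=> Bwf Swf; pose R (s s' : {fset nat}) :=
  s = (n |` s')%fset /\ forall x, x \in s' -> n < x.
apply: (@rank_simulation _ _ R) => //; last first.
  by split=> [|x]; rewrite ?inE// fsetU0.
move=> _ s' t [-> s'n] [[w Bw [tw wseg]] [st tseg] /eqP sNt].
have nt : n \in t by apply: st; rewrite /= !inE eqxx.
have nw : n \in w by apply: tw.
have tn x : x \in t -> n <= x.
  move=> xt; rewrite leqNgt; apply/negP => xn.
  have := tseg x n xt; rewrite /= !inE eqxx => /(_ isT (ltnW xn)).
  by case/orP=> [/eqP xn'|/s'n]; [rewrite xn' ltnn in xn|rewrite ltnNge ltnW].
have wn x : x \in w -> n <= x.
  move=> xw; rewrite leqNgt; apply/negP => xn.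
  by have /tn := wseg x n xw nt (ltnW xn); rewrite leqNgt xn.
exists (t `\ n)%fset; last first.
  split=> [|x]; first by rewrite fsetD1K.
  by rewrite !inE => /andP[xn /tn]; rewrite ltn_neqAle eq_sym xn.
have s't : [set` s'] `<=` [set` (t `\ n)%fset].
  move=> x /= xs'; rewrite !inE (_ : x \in t) ?andbT.
    by have := s'n x xs'; case: ltngtP.
  by apply: st; rewrite /= !inE xs' orbT.
split.
- exists (w `\ n)%fset; first by exists w.
  split=> [x /=|x k /=]; rewrite !inE => /andP[-> //]; first by move=> /tw.
  by move=> xw /andP[_ kt] xk; rewrite (wseg x k).
- split=> // x k /=; rewrite !inE => /andP[xn xt] ks' xk.
  have := tseg x k xt; rewrite /= !inE (negPf xn) ks' orbT; exact.
- by move=> E; case/eqP: sNt; rewrite E fsetD1K.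
Qed.

(** * Sections, the ideal [FIN] and uniform barriers *)

Lemma barrier_thin M B : barrier M B -> thin B.
Proof. by move=> [_ _ anti _] s t Bs Bt /initseg_fsub; apply: anti. Qed.

Lemma minpart_uniq B n m s : minpart B n s -> minpart B m s -> n = m.
Proof.
by move=> [_ ns nmin] [_ ms mmin]; apply/eqP; rewrite eqn_leq nmin// mmin.
Qed.

Lemma section_sub X X' n : X `<=` X' -> section X n `<=` section X' n.
Proof. by move=> XX' _ [s [/XX' Xs ns smin] <-]; exists s. Qed.

Lemma section_minpart0 B n : ~ (minpart B n !=set0) -> section B n = set0.
Proof. by move=> B0; rewrite -subset0 => t [s Bs _]; apply: B0; exists s. Qed.

Lemma FIN_sub B X X' : FIN B X -> X' `<=` X -> FIN B X'.
Proof.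
move=> BX; elim: BX X' => {B X}[B X B0 X0 X'|B X F B0 XB _ IH X' X'X].
  by rewrite X0 subset0 => ->; apply: FIN0.
apply: (FINS (F := F)) => //; first exact: subset_trans XB.
by move=> n Bn nF; apply: IH => //; apply: section_sub.
Qed.

Lemma FIN_setU B X X' : FIN B X -> FIN B X' -> FIN B (X `|` X').
Proof.
move=> BX; elim: BX X' => {B X}[B X B0 X0 X' [_ ->|//]|B X F B0 XB _ IH X' []//].
  by apply: FIN0; rewrite // X0 setU0.
move=> F' _ X'B H'; apply: (FINS (F := (F `|` F')%fset)) => //.
  by move=> s [/XB|/X'B].
move=> n Bn; rewrite inE negb_or => /andP[nF nF'].
apply: FIN_sub (IH n Bn nF _ (H' n Bn nF')) _.
by move=> _ [s [[Xs|Xs] ns smin] <-]; [left|right]; exists s.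
Qed.

Lemma FIN_bigU B (D : nat -> set {fset nat}) k : FIN B set0 ->
  (forall m, FIN B (D m)) -> FIN B [set s | exists2 m, m <= k & D m s].
Proof.
move=> B0 DF; elim: k => [|k IH].
  by apply: FIN_sub (DF 0) _ => s [m]; rewrite leqn0 => /eqP->.
apply: FIN_sub (FIN_setU IH (DF k.+1)) _ => s [m].
by rewrite leq_eqVlt => /orP[/eqP->|mk] Ds; [right|left; exists m].
Qed.

Lemma initseg0 (X : set nat) : initseg [set` (fset0 : {fset nat})] X.
Proof. by split=> [x|x k _]; rewrite /= inE. Qed.

Lemma barrier_fset0 M : infinite_set M -> barrier M [set fset0].
Proof.
move=> Minf; split=> //.
- by move=> _ -> x; rewrite /= inE.
- by move=> s t -> ->.
- by move=> N _ _; exists fset0 => //; apply: initseg0.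
Qed.

Lemma rho_fset0 a : ~ olt a (rho [set fset0]).
Proof.
move=> /(olt_rank (barrier_wf (barrier_fset0 infinite_nat)))[t].
by move=> [[_ -> /initseg_fsub]]; rewrite fsubset0 => /eqP-> _ [].
Qed.

Lemma section_singletons M n : M n -> section (singletons M) n = [set fset0].
Proof.
move=> Mn; apply/seteqP; split=> [_ [_ [[m _ <-]] + _ <-]|_ ->].
  by rewrite inE => /eqP->; apply/fsetP => x; rewrite !inE andNb.
exists [fset n]%fset; last by apply/fsetP => x; rewrite !inE andNb.
split; [by exists n|by rewrite inE|].
by move=> m; rewrite inE => /eqP->.
Qed.

Lemma minpart_base M B n : barrier M B -> minpart B n !=set0 -> M n.
Proof. by move=> [_ BM _ _] [s [/BM sM ns _]]; apply: sM. Qed.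

Lemma uniform_barrier M C : uniform M C -> barrier M C.
Proof. by case. Qed.

Lemma infinite_barrier M C : barrier M C -> infinite_set M.
Proof. by case. Qed.

(* Uniformity enters only here: all but finitely many sections of [C] have
   rank at least any ordinal below the rank of [C]. *)
Lemma uniform_sections M C a : uniform M C -> olt a (rho C) ->
  C <> [set fset0] /\ exists F : {fset nat}, forall n, M n -> n \notin F ->
    uniform (tail M n) (section C n) /\ ole a (rho (section C n)).
Proof.
move=> Cu aC; have C0 : C <> [set fset0].
  by move=> C0; move: aC; rewrite C0 => /rho_fset0.
split=> //; have Cb := uniform_barrier Cu; have Cwf := barrier_wf Cb.
have rankC n : uniform (tail M n) (section C n) ->
    ole (rank (tree C) [fset n]%fset) (rho (section C n)).
  by move=> /uniform_barrier/barrier_wf; apply: rank_section.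
case: Cu => [//|_ CE|b _ _ Cn rC rn|_ _ Cn _ rmono [_ rsup]].
- exists fset0 => n Mn _; split.
    rewrite CE section_singletons//; apply: Uniform0 => //.
    exact/barrier_fset0/infinite_tail/(infinite_barrier Cb).
  (* A nonempty node [t] in the tree of the singletons is a leaf, so [a], bounded by its rank, is
     below every ordinal. *)
  have [t [Ct _ t0] at_] := olt_rank Cwf aC.
  apply: (ole_trans at_); apply: rank_leaf => // w [].
  move: Ct; rewrite CE => -[_ [m _ <-] /initseg_fsub tm].
  move=> [_ [k _ <-] /initseg_fsub wk] /initseg_fsub tw.
  have wt : #|` w | <= #|` t |.
    apply: (leq_trans (fsubset_leq_card wk)); rewrite cardfs1 cardfs_gt0.
    by apply/eqP => /esym.
  by case; apply/eqP; rewrite eqEfcard tw.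
- exists fset0 => n Mn _; split; first exact: Cn.
  apply: ole_trans (rankC n (Cn n Mn)); apply: (@ole_trans b); last by case: (rn n Mn).
  by apply: olt_osucc; apply: (ole_trans aC); case: rC.
(* Limit case: the supremum exceeds [a], hence so does some rank; as the ranks increase, only the
   [n] below [n0] are exceptional. *)
have [n0 [Mn0 an0]] : exists n0, M n0 /\ olt a (rank (tree C) [fset n0]%fset).
  apply: contrapT => nex; apply: (@olt_irr a); apply: (ole_trans aC).
  apply: rsup => n Mn; have [//|an] := ole_or_olt (rank (tree C) [fset n]%fset) a.
  by case: nex; exists n.
exists [fset n in iota 0 n0]%fset => n Mn; rewrite !inE mem_iota /= add0n -leqNgt => n0n.
split; first exact: Cn.
apply: ole_trans (rankC n (Cn n Mn)); apply: (ole_trans (oltW an0)).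
move: n0n; rewrite leq_eqVlt => /orP[/eqP->|n0n]; first exact: ole_refl.
exact/oltW/rmono.
Qed.

Lemma section_set0 n : section set0 n = set0.
Proof. by apply: section_minpart0 => -[s []]. Qed.

(** [FIN] is inductive, so even the empty set needs a recursion through sections down to
    [[set fset0]]; the derivation of uniformity supplies it. *)
Lemma uniform_FIN0 M C : uniform M C -> FIN C set0.
Proof.
move=> Cu; elim: Cu => {M C}[M C _ C0|M C Cb C1|M C b Cb r1 _ IH _ _|M C Cb r1 _ IH _ _ _].
- exact: FIN0.
- apply: (FINS (F := fset0)) => // [C0|n /(minpart_base Cb) Mn _].
    have [n Mn] := infinite_setN0 (infinite_barrier Cb).
    have : C [fset n]%fset by rewrite C1; exists n.
    by rewrite C0 => /(congr1 (fun s : {fset nat} => n \in s)); rewrite !inE eqxx.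
  by rewrite C1 section_singletons// section_set0; apply: FIN0.
- apply: (FINS (F := fset0)) => // [C0|n /(minpart_base Cb) Mn _].
    by move: r1; rewrite C0 => /rho_fset0.
  by rewrite section_set0; apply: IH.
- apply: (FINS (F := fset0)) => // [C0|n /(minpart_base Cb) Mn _].
    by move: r1; rewrite C0 => /rho_fset0.
  by rewrite section_set0; apply: IH.
Qed.

(** * Shrinking the base set until the image lies in [FIN] *)

Lemma finite_bounded (A : set nat) : finite_set A ->
  exists k, forall x, A x -> x <= k.
Proof.
move=> /finite_fsetP[F ->]; exists (\max_(x <- F) x) => x /= xF.
exact: leq_bigmax_seq.
Qed.

Lemma finite_setD_sub (Z X X' : set nat) : X' `<=` X ->
  finite_set (Z `\` X') -> finite_set (Z `\` X).
Proof. by move=> X'X; apply: sub_finite_set => x [Zx nXx]; split=> // /X'X. Qed.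

Lemma finite_setD_tail (Z X : set nat) k :
  finite_set (Z `\` X) -> finite_set (Z `\` tail X k).
Proof.
move=> ZX; apply: (@sub_finite_set _ _ ((Z `\` X) `|` `I_k.+1)).
  move=> x [Zx nX]; have [kx|] := ltnP k x; last by right.
  by left; split=> // Xx; apply: nX.
by rewrite finite_setU; split=> //; apply: finite_II.
Qed.

(* If some [minpart C n] captures all of [f] on a subset of [Y], take that [n];
   otherwise Nash-Williams makes [f] avoid each [minpart C n] in turn. *)
Lemma avoid_minparts B C u (f : {fset nat} -> {fset nat}) Y :
  well_founded (pext (tree B)) -> thin B -> infinite_set Y ->
  exists n0 Y', [/\ infinite_set Y', Y' `<=` Y &
    forall n X, n <> n0 -> infinite_set X -> X `<=` Y' ->
      exists X', [/\ infinite_set X', X' `<=` X &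
        forall s, through B u X' s -> ~ minpart C n (f s)]].
Proof.
move=> Bwf Bthin Yinf; pose S n := [set s | minpart C n (f s)].
have [[n0 [Y' [Y'inf Y'Y Y'S]]]|noconst] := pselect (exists n0 Y',
    [/\ infinite_set Y', Y' `<=` Y & through B u Y' `<=` S n0]).
  exists n0, Y'; split=> // n X nn0 Xinf XY'; exists X; split=> // s us fn; apply: nn0.
  by apply: (minpart_uniq fn); apply/Y'S/(through_sub XY').
exists 0, Y; split=> // n X _ Xinf XY.
have [X' [X'inf X'X [X'S|X'S]]] := nash_williams (S n) u Bwf Bthin Xinf.
  by case: noconst; exists n, X'; split=> //; apply: subset_trans XY.
by exists X'.
Qed.

(* The conclusion is stated for all [Z] almost contained in [X] so that it
   survives diagonalization over all [n] at once. *)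
Lemma image_FIN B u M C (f : {fset nat} -> {fset nat}) Y :
  well_founded (pext (tree B)) -> thin B -> uniform M C ->
  olt (rank (tree B) u) (rho C) -> infinite_set Y ->
  exists X, [/\ infinite_set X, X `<=` Y & forall Z, finite_set (Z `\` X) ->
    FIN C ((f @` through B u Z) `&` C)].
Proof.
move=> Bwf Bthin; elim/(well_founded_ind Bwf): u M C f Y => u IH M C f Y Cu uC Yinf.
have Cb := uniform_barrier Cu.
have [C0 [F CF]] := uniform_sections Cu uC.
have secU n : minpart C n !=set0 -> n \notin F -> FIN (section C n) set0.
  by move=> /(minpart_base Cb) Mn nF; have [/uniform_FIN0] := CF n Mn nF.
have secF n A : minpart C n !=set0 -> n \notin F ->
    ~ (minpart A n !=set0) -> FIN (section C n) (section A n).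
  by move=> Cn nF /section_minpart0 ->; apply: secU.
(* At a leaf the image has at most the point [f u], so its sections are empty except possibly at the
   minimum of [f u]. *)
have [Bu|nBu] := pselect (B u).
  exists Y; split=> // Z _.
  have [[n fn]|nf] := pselect (exists n, minpart C n (f u)).
    apply: (FINS (F := (n |` F)%fset)) => // k Ck.
    rewrite !inE negb_or => /andP[/eqP kn kF]; apply: secF => // -[s].
    move=> [[[t /(through_leaf Bthin Bu) -> <-] Cs] ks smin]; apply: kn.
    by apply: minpart_uniq fn; split.
  apply: (FINS (F := F)) => // k Ck kF; apply: secF => // -[s].
  move=> [[[t /(through_leaf Bthin Bu) -> <-] Cs] ks smin]; apply: nf.
  by exists k.
have [n0 [Y' [Y'inf Y'Y avoid]]] := avoid_minparts C u f Bwf Bthin Yinf.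
(* The share of the [n]-th section of the image that comes from the child adding [m]; it is empty if
   there is no such child. *)
pose img m n Z :=
  [set s | pext (tree B) (m |` u)%fset u /\
     ((fun t => f t `\ n)%fset @` through B (m |` u)%fset Z `&` section C n) s].
(* One index [i] carries two tasks: as a number [n], avoid [minpart C n]; as the code of a pair, put
   [img m n] into the ideal of the section. *)
pose P i X := forall n, M n -> n \notin F ->
  (n <> n0 -> n = i -> forall s, through B u X s -> ~ minpart C n (f s)) /\
  (forall m, i = choice.pickle (m, n) -> forall Z, finite_set (Z `\` X) ->
     FIN (section C n) (img m n Z)).
have Phered i X X' : X' `<=` X -> P i X -> P i X'.
  move=> X'X PX n Mn nF; have [av im] := PX n Mn nF; split.
    by move=> nn0 ni s /(through_sub X'X); apply: av.
  by move=> m im' Z /(finite_setD_sub X'X); apply: im.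
have Pdense i X : infinite_set X -> X `<=` Y' ->
    exists X', [/\ infinite_set X', X' `<=` X & P i X'].
  move=> Xinf XY'.
  have [X1 [X1inf X1X avX1]] : exists X1, [/\ infinite_set X1, X1 `<=` X &
      i <> n0 -> forall s, through B u X1 s -> ~ minpart C i (f s)].
    have [in0|in0] := pselect (i = n0); first by exists X; split.
    by have [X1 [? ? ?]] := avoid i X in0 Xinf XY'; exists X1.
  have avX1' X' : X' `<=` X1 -> forall n, n <> n0 -> n = i ->
      forall s, through B u X' s -> ~ minpart C n (f s).
    by move=> X'X1 n nn0 ni s /(through_sub X'X1); rewrite ni in nn0 *; apply: avX1.
  have [[m [n [imn Mn nF mu]]]|none] := pselect (exists m n, [/\ i = choice.pickle (m, n),
      M n, n \notin F & pext (tree B) (m |` u)%fset u]).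
    have [Cn uCn] := CF n Mn nF.
    (* The child has rank below that of [u], hence below that of [section C n], so the induction
       hypothesis applies to [f] with [n] deleted. *)
    have mCn := ole_trans (rank_pext Bwf mu) uCn.
    have [X2 [X2inf X2X1 FX2]] := IH _ mu _ _ (fun t => f t `\ n)%fset X1 Cn mCn X1inf.
    exists X2; split=> //; first exact: subset_trans X1X.
    move=> n' Mn' nF'; split; first exact: avX1'.
    move=> m' imn'; have : Some (m, n) = Some (m', n').
      by rewrite -(choice.pickleK (m, n)) -imn imn' choice.pickleK.
    by move=> [<- <-] Z /FX2 FZ; apply: FIN_sub FZ _ => s [].
  exists X1; split=> // n Mn nF; split; first exact: avX1'.
  move=> m imn Z _; apply: FIN_sub (uniform_FIN0 (CF n Mn nF).1) _ => s [mu _].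
  by apply: none; exists m, n.
have [X [Xinf XY' PX]] := diagonal_subset Phered Pdense Y'inf.
(* Each condition holds only on a tail of [X]; since [Z] is almost contained in every tail, this
   suffices. *)
have PXi i : exists k, P i (tail X k).
  by have [k Xk ik] := infinite_mem_gt i Xinf; exists k; apply: PX => //; apply: ltnW.
exists X; split=> //; first exact: subset_trans Y'Y.
move=> Z ZX; apply: (FINS (F := (n0 |` F)%fset)) => // n Cn.
rewrite !inE negb_or => /andP[/eqP nn0 nF]; have Mn := minpart_base Cb Cn.
have imgF m : FIN (section C n) (img m n Z).
  have [k Pk] := PXi (choice.pickle (m, n)); have [_ im] := Pk n Mn nF.
  by apply: im (erefl _) _ _; apply: finite_setD_tail.
have [k Pk] := PXi n; have [/(_ nn0 (erefl _)) av _] := Pk n Mn nF.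
(* Beyond [k'] the set [Z] lies in the tail where [minpart C n] is avoided, so only the children
   with [m <= k'] contribute to the section. *)
have [k' ZXk'] := finite_bounded (finite_setD_tail k ZX).
apply: FIN_sub (FIN_bigU k' (secU n Cn nF) imgF) _.
move=> _ [s [[[t ut <-] Cft] nft ftmin] <-].
have tu : t <> u by move=> E; apply: nBu; rewrite -E; case: ut.
have [m [Zm mu mt]] := through_child ut tu.
have Zk' x : Z x -> k' < x -> tail X k x.
  move=> Zx k'x; apply: contrapT => nx.
  by have := ZXk' x (conj Zx nx); rewrite leqNgt k'x.
exists m; last first.
  split=> //; split; last by exists (f t).
  by exists t => //; apply: through_sub mt => x [].
(* If [m] exceeded [k'], so would all elements of [t] outside [u], and [t] would run through that
   tail, where [f t] cannot have minimum [n]. *)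
rewrite leqNgt; apply/negP => k'm; apply: (av t); last by split.
have [Bt useg _] := ut; have [_ _ tm] := mt; split=> // x /tm[|[Zx mx]].
  by rewrite !inE => /orP[/eqP->|]; [right; apply: Zk'|left].
by right; apply: Zk' => //; apply: ltn_trans mx.
Qed.

Theorem theorem5p14 (B C : set {fset nat})
    (hB : barrier [set: nat] B) (hC : barrier [set: nat] C)
    (hCu : uniform [set: nat] C) (hrho : olt (rho B) (rho C)) :
  ~ katetov_le C (FIN C) B (Gc B).
Proof.
move=> [f fBC fK].
(* Take the root [fset0], whose rank is [rho B]: the image of [B|X] is in [FIN C], but its preimage
   contains [B|X] and so is not in [Gc B]. *)
have [X [Xinf _ FX]] := image_FIN f (barrier_wf hB) (barrier_thin hB) hCu hrho infinite_nat.
have XX : finite_set (X `\` X) by rewrite setDv.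
have [_] := fK _ (FX X XX); apply; exists X; split=> // s [Bs sX].
split=> //; split; last exact: fBC.
by exists s => //; split=> [//||x xs]; [apply: initseg0|right; apply: sX].
Qed.
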